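(* Let $d\ge 2$, let $A_0B_0$ and $A_1B_1$ be unit segments in $\mathbb{R}^d$, and let $h\ge 0$ be the distance between the lines containing them. Assume that the angle between the directions $\overrightarrow{A_0B_0}$ and $\overrightarrow{A_1B_1}$ is $\theta$, with $0<|\theta|\le \pi$. Then every continuous rigid motion transforming $A_0B_0$ into $A_1B_1$ (taking $A_0$ to $A_1$ and $B_0$ to $B_1$) satisfies $$L(A_0B_0,A_1B_1)\ge \sqrt{\theta^2+4h^2\cos^2\frac{\theta}{2}}.$$
   Context: A continuous rigid motion transforming the unit segment $A_0B_0$ into the unit segment $A_1B_1$ is described by the trajectories of its endpoints: continuous curves $A,B:[0,1]\to\mathbb{R}^d$ with $A(0)=A_0$, $B(0)=B_0$, $A(1)=A_1$, $B(1)=B_1$ and $|B(t)-A(t)|=1$ for all $t\in[0,1]$. For such a motion, $L(A_0B_0,A_1B_1):=L(A_0)+L(B_0)$ denotes the sum of the lengths of the two curves $A(t)$ and $B(t)$, $t\in[0,1]$ (so this number depends on the motion). Only motions with $L(A_0B_0,A_1B_1)<\infty$ are considered; after a reparametrization, which does not change lengths, $A(t)$ and $B(t)$ are assumed to be Lipschitz. The angle $\theta$ is a signed angle in $(-\pi,\pi]$ between the vectors $\overrightarrow{A_0B_0}$ and $\overrightarrow{A_1B_1}$; only $|\theta|\in[0,\pi]$, the usual unsigned angle between these vectors, matters here. The distance between two lines is the infimum of the distances between a point of one and a point of the other. *)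

(* Defs.v *)
From HB Require Import structures.
From mathcomp Require Import all_boot all_order all_algebra.
From mathcomp Require Import all_classical all_reals all_analysis.

Set Implicit Arguments.
Unset Strict Implicit.
Unset Printing Implicit Defensive.

Import Order.TTheory GRing.Theory Num.Theory.
Import numFieldNormedType.Exports.

Local Open Scope classical_set_scope.
Local Open Scope ring_scope.

Section Euclidean.
Context {R : realType} {d : nat}.
Implicit Types (u v a b : 'rV[R]_d) (X Y : set 'rV[R]_d).

Definition dot u v : R := \sum_(i < d) u 0 i * v 0 i.

(* The library norm `|u| on 'rV[R]_d is the sup norm, so the Euclidean norm
   is defined separately; the two induce the same topology. *)
Definition enorm u : R := Num.sqrt (dot u u).

(* Unsigned angle, in [0, pi], between nonzero vectors. *)
Definition angle u v : R := acos (dot u v / (enorm u * enorm v)).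

Definition line a b : set 'rV[R]_d := [set a + s *: (b - a) | s in [set: R]].

(* Meaningful for nonempty X and Y only: inf set0 = 0. *)
Definition set_dist X Y : R := inf [set enorm (p - q) | p in X & q in Y].

(* Supremum of the lengths of the inscribed polygons; it is +oo when the curve
   is not rectifiable. The vertices are the values of f at the points of a
   subdivision x :: s of [x, y], the analogue of [variation] for vector-valued
   functions. *)
Definition polygon_length (x y : R) (f : R -> 'rV[R]_d) (s : seq R) : R :=
  let F := f \o nth y (x :: s) in \sum_(0 <= n < size s) enorm (F n.+1 - F n).

Definition curve_length (x y : R) (f : R -> 'rV[R]_d) : \bar R :=
  ereal_sup [set (polygon_length x y f s)%:E | s in itv_partition x y].

(* A and B are the trajectories of the endpoints; only their restrictions to
   [0, 1] matter. *)
Record rigid_motion (A0 B0 A1 B1 : 'rV[R]_d) (A B : R -> 'rV[R]_d) : Prop :=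
  RigidMotion {
    rigid_motion_contl : {within `[0, 1], continuous A};
    rigid_motion_contr : {within `[0, 1], continuous B};
    rigid_motion_A0 : A 0 = A0;
    rigid_motion_B0 : B 0 = B0;
    rigid_motion_A1 : A 1 = A1;
    rigid_motion_B1 : B 1 = B1;
    rigid_motion_unit : forall t : R, 0 <= t <= 1 -> enorm (B t - A t) = 1
  }.

Definition motion_length (A B : R -> 'rV[R]_d) : \bar R :=
  (curve_length 0 1 A + curve_length 0 1 B)%E.

End Euclidean.

(* Main.v *)
Require Import Defs.
From HB Require Import structures.
From mathcomp Require Import all_boot all_order all_algebra.
From mathcomp Require Import all_classical all_reals all_analysis.
From mathcomp Require Import ring lra.

(* Write u = B - A, project along the common perpendicular e of the two lines, and
   let w be the part of u orthogonal to e, sigma = <u, e> and s = <A + B, e>. With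
   S = sin (theta / 2) and c = cos (theta / 2), every displacement satisfies
     |dA| + |dB| >= sqrt (|dw|^2 + S^2 dsigma^2 + c^2 ds^2),
   and s increases by 2h in total, so it is enough that (w, S sigma), which runs on
   an oblate ellipsoid between two points of the equator, has length >= theta.
   Dividing longitudes by S maps it to the unit sphere and stretches distances at
   most by the factor 1 / S; the endpoints become points of the equator at distance
   theta / S, which is at most pi since theta <= pi sin (theta / 2). The curves are
   only continuous, so all estimates are made on chords of a fine polygon. *)

Set Implicit Arguments.
Unset Strict Implicit.
Unset Printing Implicit Defensive.

Import Order.TTheory GRing.Theory Num.Theory.
Import numFieldNormedType.Exports.

Local Open Scope classical_set_scope.
Local Open Scope ring_scope.

(** * Trigonometric inequalities and the comparison of arcs with chords *)

Section Trigonometry.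
Context {R : realType}.
Implicit Types (a b c k r s t x y : R).

Lemma ler_cos x y : 0 <= x -> y <= pi -> x <= y -> cos y <= cos x.
Proof.
move=> x0 ypi; rewrite le_eqVlt => /predU1P[->//|xy]; apply: ltW.
by rewrite ltr_cos// !in_itv/= ?x0 ?ypi ?(le_trans _ (ltW xy))// (le_trans (ltW xy)).
Qed.

Lemma mul_cos_le_sin x : 0 <= x <= pi / 2 -> x * cos x <= sin x.
Proof.
move=> /andP[x0 xpi].
have := @MVT_segment R sin cos 0 x x0 (fun y _ => is_derive_sin y)
  (continuous_subspaceT (@continuous_sin R)).
case=> y; rewrite in_itv/= => /andP[y0 yx].
rewrite sin0 !subr0 => ->; rewrite mulrC ler_wpM2r//.
by apply: ler_cos => //; have := @pi_ge0 R; lra.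
Qed.

(** The difference [sin (k * z) - k * sin z] vanishes at 0 and has derivative
    [k * (cos (k * y) - cos y) >= 0]. *)
Lemma mul_sin_le_sin_mul k x : 0 <= k <= 1 -> 0 <= x <= pi / 2 ->
  k * sin x <= sin (k * x).
Proof.
move=> /andP[k0 k1] /andP[x0 xpi].
have is_derivek y : is_derive y 1 (fun z : R => k * z) k.
  by apply: is_derive_eq; rewrite /GRing.scale/= mulr1.
have dk y : is_derive y 1 (fun z : R => sin (k * z) - k * sin z)
    (k * cos (k * y) - k * cos y).
  apply: is_deriveB.
  have -> : k * cos (k * y) = cos (k * y) * k by rewrite mulrC.
  by apply: is_derive1_comp; exact: is_derivek.
have ck : continuous (fun z : R => sin (k * z) - k * sin z).
  move=> y; apply: differentiable_continuous.
  by apply/derivable1_diffP; case: (dk y).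
have := @MVT_segment R _ _ 0 x x0 (fun y _ => dk y) (continuous_subspaceT ck).
case=> y; rewrite in_itv/= => /andP[y0 yx].
rewrite !mulr0 sin0 mulr0 !subr0 -mulrBr => E.
rewrite -subr_ge0 E mulr_ge0// mulr_ge0// subr_ge0.
apply: ler_cos; rewrite ?mulr_ge0//; last by rewrite ler_piMl.
by have := @pi_ge0 R; lra.
Qed.

Lemma one_minus_cosE x : 1 - cos x = 2 * sin (x / 2) ^+ 2.
Proof.
have -> : cos x = cos ((x / 2) *+ 2) by congr cos; rewrite -mulr_natr divfK.
by rewrite cos_mulr2n sin2cos2; ring.
Qed.

(** In half angles this is the square of [k * sin (x / 2) <= sin (k * x / 2)]. It is used with
    [k = S], [x] a difference of stretched longitudes and [y] the angle between two projections. *)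
Lemma scaled_versine_le k x y : 0 <= k <= 1 -> 0 <= x <= pi -> k * x <= y -> y <= pi ->
  k ^+ 2 * (1 - cos x) <= 1 - cos y.
Proof.
move=> k01 x0 kxy ypi; case/andP: (k01) => k0 k1; case/andP: (x0) => x0' xpi.
apply: (@le_trans _ _ (1 - cos (k * x))); last first.
  by rewrite lerB// ler_cos// mulr_ge0.
rewrite !one_minus_cosE.
have kk : 0 <= k * sin (x / 2) <= sin (k * x / 2).
  rewrite -mulrA mul_sin_le_sin_mul// ?andbT; last by lra.
  by rewrite mulr_ge0// sin_ge0_pi; lra.
nra.
Qed.

(** The case of [mul_sin_le_sin_mul] with factor [x / pi] at the point [pi / 2]. *)
Lemma mul_pi_le_sin_half x : 0 <= x <= pi -> x <= pi * sin (x / 2).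
Proof.
move=> /andP[x0 xpi]; have pi0 := @pi_gt0 R.
have := @mul_sin_le_sin_mul (x / pi) (pi / 2).
rewrite sin_pihalf mulr1 => H.
have {}H : x / pi <= sin (x / pi * (pi / 2)).
  by apply: H; last lra; rewrite divr_ge0 ?ler_pdivrMr ?mul1r// ltW.
move: H; rewrite mulrA divfK ?gt_eqF// ler_pdivrMr//.
by rewrite mulrC.
Qed.

(** [Num.sqrt (2 - 2 * c)] is the chord of an arc of length [acos c] on the unit circle, so the
    factor lost between arc and chord tends to 1 as the chord shrinks. For an arc [x] the chord is
    [2 * sin (x / 2)], and [cos (x / 2) >= 1 - sin (x / 2)]. *)
Lemma acos_mul_le_chord c : -1 <= c <= 1 ->
  (1 - Num.sqrt (2 - 2 * c) / 2) * acos c <= Num.sqrt (2 - 2 * c).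
Proof.
move=> c1; set x := acos c.
have x0 : 0 <= x by exact: acos_ge0.
have xpi : x <= pi by exact: acos_lepi.
have cE : c = cos x by rewrite /x acosK// in_itv.
have s0 : 0 <= sin (x / 2) by apply: sin_ge0_pi; lra.
have c0 : 0 <= cos (x / 2) by apply: cos_ge0_pihalf; lra.
have -> : 2 - 2 * c = (2 * sin (x / 2)) ^+ 2.
  by rewrite exprMn expr2 -mulrA -one_minus_cosE cE; ring.
rewrite sqrtr_sqr ger0_norm ?mulr_ge0//.
have := @mul_cos_le_sin (x / 2); rewrite divr_ge0//= ler_pM2r// => /(_ xpi) H.
have cs := cos2Dsin2 (x / 2).
have h : 1 - sin (x / 2) <= cos (x / 2) by have := sin_le1 (x / 2); nra.
have -> : 2 * sin (x / 2) / 2 = sin (x / 2) by rewrite mulrC mulKf.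
nra.
Qed.

(* Triangle inequality on the sphere: [a] and [b] are the cosines of the
   distances from two points to a third one, [c] that of their distance. *)
Lemma acos_triangle a b c : -1 <= a <= 1 -> -1 <= b <= 1 -> -1 <= c <= 1 ->
  (c - a * b) ^+ 2 <= (1 - a ^+ 2) * (1 - b ^+ 2) ->
  `|acos a - acos b| <= acos c.
Proof.
move=> a1 b1 c1 H.
have L x y : -1 <= x <= 1 -> -1 <= y <= 1 ->
    (c - x * y) ^+ 2 <= (1 - x ^+ 2) * (1 - y ^+ 2) ->
  acos x - acos y <= acos c.
  move=> x1 y1 Hxy; rewrite leNgt; apply/negP => lt.
  have xpi := acos_lepi x1; have y0 := acos_ge0 y1; have c0 := acos_ge0 c1.
  have : cos (acos x - acos y) < cos (acos c).
    by rewrite ltr_cos// in_itv/= ?acos_ge0 ?acos_lepi//; lra.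
  rewrite cosB !acosK ?in_itv// !sin_acos// -sqrtrM ?subr_ge0; last by nra.
  apply/negP; rewrite -leNgt -lerBlDl.
  by rewrite (le_trans (ler_norm _))// -sqrtr_sqr ler_wsqrtr.
rewrite ler_norml L// andbT lerNl opprB L//.
by rewrite mulrC [leRHS]mulrC.
Qed.

End Trigonometry.

(** * The Euclidean inner product and norm *)

Section EuclideanNorm.
Context {R : realType} {d : nat}.
Implicit Types (u v w : 'rV[R]_d) (k : R).

Lemma dotC u v : dot u v = dot v u.
Proof. by apply: eq_bigr => i _; rewrite mulrC. Qed.

Lemma dotDl u v w : dot (u + v) w = dot u w + dot v w.
Proof. by rewrite -big_split; apply: eq_bigr => i _; rewrite mxE mulrDl. Qed.

Lemma dotZl k u v : dot (k *: u) v = k * dot u v.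
Proof. by rewrite mulr_sumr; apply: eq_bigr => i _; rewrite mxE mulrA. Qed.

Lemma dotNl u v : dot (- u) v = - dot u v.
Proof. by rewrite -scaleN1r dotZl mulN1r. Qed.

Lemma dotDr u v w : dot u (v + w) = dot u v + dot u w.
Proof. by rewrite ![dot u _]dotC dotDl. Qed.

Lemma dotZr k u v : dot u (k *: v) = k * dot u v.
Proof. by rewrite ![dot u _]dotC dotZl. Qed.

Lemma dotNr u v : dot u (- v) = - dot u v.
Proof. by rewrite ![dot u _]dotC dotNl. Qed.

Definition dotE := (dotDl, dotDr, dotNl, dotNr, dotZl, dotZr).

Lemma dot_ge0 u : 0 <= dot u u.
Proof. by apply: sumr_ge0 => i _; rewrite -expr2 sqr_ge0. Qed.

Lemma enorm_ge0 u : 0 <= enorm u. Proof. exact: sqrtr_ge0. Qed.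

Lemma sqr_enorm u : enorm u ^+ 2 = dot u u.
Proof. by rewrite sqr_sqrtr// dot_ge0. Qed.

Lemma enormN u : enorm (- u) = enorm u.
Proof. by rewrite /enorm !dotE opprK. Qed.

Lemma sqr_enormB u v : enorm (u - v) ^+ 2 = enorm u ^+ 2 + enorm v ^+ 2 - 2 * dot u v.
Proof. by rewrite !sqr_enorm !dotE (dotC v u); ring. Qed.

Lemma enorm_eq0 u : enorm u = 0 -> u = 0.
Proof.
move=> u0; have : dot u u = 0 by rewrite -sqr_enorm u0 expr0n.
move/psumr_eq0P => H; apply/rowP => i; rewrite mxE.
by apply/eqP; rewrite -sqrf_eq0 expr2 H// => j _; rewrite -expr2 sqr_ge0.
Qed.

Lemma dot_sqr_le u v : dot u v ^+ 2 <= dot u u * dot v v.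
Proof.
have [/eqP v0|v0] := boolP (dot v v == 0).
  have -> : v = 0 by apply: enorm_eq0; rewrite /enorm v0 sqrtr0.
  by rewrite -(scale0r v) dotZr !mul0r expr0n/= dotZr mul0r mulr0.
have vp : 0 < dot v v by rewrite lt_def v0 dot_ge0.
have := dot_ge0 (dot v v *: u - dot u v *: v).
rewrite (_ : dot _ _ = dot v v * (dot u u * dot v v - dot u v ^+ 2)); last first.
  by rewrite !dotE (dotC v u); ring.
by rewrite pmulr_rge0// subr_ge0.
Qed.

Lemma normr_dot_le u v : `|dot u v| <= enorm u * enorm v.
Proof.
rewrite -(@ler_pXn2r _ 2) ?nnegrE ?mulr_ge0 ?enorm_ge0//.
by rewrite real_normK ?num_real// exprMn !sqr_enorm dot_sqr_le.
Qed.

Lemma ler_enormD u v : enorm (u + v) <= enorm u + enorm v.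
Proof.
rewrite -(@ler_pXn2r _ 2) ?nnegrE ?addr_ge0 ?enorm_ge0//.
rewrite sqrrD !sqr_enorm !dotE (dotC v u).
have := normr_dot_le u v; rewrite ler_norml => /andP[_].
by rewrite -mulr_natr; lra.
Qed.

(** Transfers continuity from the sup norm to [enorm]; the crude factor [d%:R] is enough for
    this. *)
Lemma enorm_le_norm u : enorm u <= d%:R * `|u|.
Proof.
have ui i : u 0 i ^+ 2 <= `|u| ^+ 2.
  rewrite -real_normK ?num_real// ler_pXn2r ?nnegrE// [leRHS]/Num.norm/= mx_normrE.
  exact: (le_bigmax _ (fun ij : 'I_1 * 'I_d => `|u ij.1 ij.2|) (0, i)).
rewrite -(@ler_pXn2r _ 2) ?nnegrE ?enorm_ge0 ?mulr_ge0//.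
rewrite sqr_enorm; apply: (@le_trans _ _ (\sum_(i < d) `|u| ^+ 2)).
  by apply: ler_sum => i _; rewrite -expr2.
rewrite sumr_const card_ord exprMn -[leLHS]mulr_natl ler_wpM2r ?sqr_ge0//.
by rewrite -natrX ler_nat; case: (d) => // n; rewrite expnS leq_pmulr.
Qed.

End EuclideanNorm.

(** * Components along [e] and orthogonal to [e] *)

Section Projection.
Context {R : realType} {d : nat}.
Variables (e : 'rV[R]_d).
(* That is, [e] is a unit vector or zero. *)
Hypothesis eP : forall x, dot x e * dot e e = dot x e.
Implicit Types (u v x y a b : 'rV[R]_d) (k S : R).

Definition proj_perp x := x - dot x e *: e.

Lemma dot_proj_perp x y : dot (proj_perp x) (proj_perp y) = dot x y - dot x e * dot y e.
Proof.
have /= := congr1 (fun z => z * dot y e) (eP x).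
by rewrite !dotE (dotC e y); lra.
Qed.

Lemma proj_perpB x y : proj_perp (x - y) = proj_perp x - proj_perp y.
Proof.
rewrite /proj_perp dotDl dotNl scalerBl opprB (addrC (dot y e *: e)) addrACA.
by rewrite opprB (addrC (- y)).
Qed.

(* Reflecting [a] in the hyperplane orthogonal to [e] turns the difference
   [b - a] into a vector with vertical component [dot (a + b) e]. *)
Lemma reflection_bound a b :
  enorm (proj_perp (b - a)) ^+ 2 + dot (a + b) e ^+ 2 <= (enorm a + enorm b) ^+ 2.
Proof.
pose a' := a - (2 * dot a e) *: e.
have /= ea := congr1 (fun z => z * dot a e) (eP a).
have -> : enorm a = enorm a'.
  rewrite /enorm !dotE (dotC e a); congr Num.sqrt.
  by move: ea; lra.
have -> : enorm (proj_perp (b - a)) ^+ 2 + dot (a + b) e ^+ 2 = enorm (b - a') ^+ 2.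
  rewrite !sqr_enorm dot_proj_perp /a' !dotE (dotC e a) (dotC e b) (dotC b a).
  by move: ea; lra.
rewrite ler_pXn2r ?nnegrE ?enorm_ge0 ?addr_ge0 ?enorm_ge0//.
by rewrite addrC -(enormN a') ler_enormD.
Qed.

(** Here [a] and [b] stand for the displacements of the two endpoints. The bound is the convex
    combination, with weights [k] and [1 - k], of the squared triangle inequality for [b - a] and of
    [reflection_bound]. *)
Lemma endpoint_speed_bound a b k : 0 <= k <= 1 ->
  enorm (proj_perp (b - a)) ^+ 2 + k * dot (b - a) e ^+ 2 + (1 - k) * dot (a + b) e ^+ 2
    <= (enorm a + enorm b) ^+ 2.
Proof.
move=> /andP[k0 k1]; have := reflection_bound a b.
have : enorm (proj_perp (b - a)) ^+ 2 + dot (b - a) e ^+ 2 <= (enorm a + enorm b) ^+ 2.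
  rewrite sqr_enorm dot_proj_perp -expr2 subrK -sqr_enorm.
  rewrite ler_pXn2r ?nnegrE ?enorm_ge0 ?addr_ge0 ?enorm_ge0//.
  by rewrite addrC -(enormN a) ler_enormD.
nra.
Qed.

End Projection.

(** * The triangle inequality for angles between unit vectors *)

Lemma unit_dot_itv (R : realType) (d : nat) (x y : 'rV[R]_d) :
  enorm x = 1 -> enorm y = 1 -> -1 <= dot x y <= 1.
Proof.
by move=> x1 y1; rewrite -ler_norml (le_trans (normr_dot_le _ _))// x1 y1 mulr1.
Qed.

Lemma angle_triangle (R : realType) (d : nat) (x y z : 'rV[R]_d) :
  enorm x = 1 -> enorm y = 1 -> enorm z = 1 ->
  `|acos (dot x y) - acos (dot x z)| <= acos (dot y z).
Proof.
move=> x1 y1 z1; apply: acos_triangle; rewrite ?unit_dot_itv//.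
have xx : dot x x = 1 by rewrite -sqr_enorm x1 expr1n.
have yy : dot y y = 1 by rewrite -sqr_enorm y1 expr1n.
have zz : dot z z = 1 by rewrite -sqr_enorm z1 expr1n.
(* [p] removes the component along [x]; Cauchy-Schwarz for [p y] and [p z] is the hypothesis of
   [acos_triangle]. *)
pose p v := v - dot x v *: x.
have pE v w : dot (p v) (p w) = dot v w - dot x v * dot x w.
  by rewrite /p !dotE (dotC v x) xx; ring.
by have := dot_sqr_le (p y) (p z); rewrite !pE yy zz -!expr2.
Qed.

(** * Stretching of longitudes on the unit sphere *)

Section LongitudeStretching.
Context {R : realType} {d : nat}.
Variables (e u0 : 'rV[R]_d) (S : R).
Hypothesis eP : forall x, dot x e * dot e e = dot x e.
Hypotheses (u0_unit : enorm u0 = 1) (u0e : dot u0 e = 0) (S01 : 0 < S <= 1).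
Implicit Types (u v : 'rV[R]_d).

(* For [proj_perp e u = 0] the division gives [acos 0]; this value is always
   multiplied by [enorm (proj_perp e u)]. *)
Definition longitude u := acos (dot u0 u / enorm (proj_perp e u)).

(** The cap keeps differences of two values within [pi] in absolute value, where [cos] is monotone;
    being 1-Lipschitz, it preserves the estimates. *)
Definition stretched u := Num.min (longitude u / S) pi.

(** For unit [u], the spherical distance from [u0] to the stretched image of [u], by the spherical
    Pythagorean theorem: [enorm (proj_perp e u)] is the cosine of the latitude. *)
Definition stretched_dist u := acos (enorm (proj_perp e u) * cos (stretched u)).

Let r u := enorm (proj_perp e u).

Let sqr_r u : enorm u = 1 -> r u ^+ 2 = 1 - dot u e ^+ 2.
Proof. by move=> u1; rewrite sqr_enorm dot_proj_perp// -sqr_enorm u1 expr1n -expr2. Qed.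

Let dot_u0 u : dot u0 u = dot u0 (proj_perp e u).
Proof. by rewrite dotDr dotNr dotZr u0e mulr0 subr0. Qed.

Lemma longitude_cos_itv u : -1 <= dot u0 u / enorm (proj_perp e u) <= 1.
Proof.
rewrite -ler_norml normrM normfV (ger0_norm (enorm_ge0 _)).
have [->|/eqP r0] := eqVneq (enorm (proj_perp e u)) 0; first by rewrite invr0 mulr0.
rewrite ler_pdivrMr ?lt_def ?enorm_ge0 ?andbT; last exact/eqP.
by rewrite dot_u0 (le_trans (normr_dot_le _ _))// u0_unit.
Qed.

Lemma longitude_lip u v : r u != 0 -> r v != 0 ->
  `|longitude u - longitude v| <=
    acos (dot (proj_perp e u) (proj_perp e v) / (r u * r v)).
Proof.
have unitr w : r w != 0 -> enorm ((r w)^-1 *: proj_perp e w) = 1.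
  move=> w0; rewrite /enorm dotZl dotZr -sqr_enorm -/(r w) (_ : _ * _ = 1) ?sqrtr1//.
  by field.
move=> ru rv; have := angle_triangle u0_unit (unitr _ ru) (unitr _ rv).
rewrite dotZl !dotZr -!dot_u0 ![_^-1 * dot u0 _]mulrC => /le_trans; apply.
by rewrite invfM mulrA mulrC.
Qed.

Lemma stretched_lip u v :
  S * `|stretched u - stretched v| <= `|longitude u - longitude v|.
Proof.
case/andP: S01 => S0 _.
have : `|stretched u - stretched v| <= `|longitude u / S - longitude v / S|.
  rewrite /stretched; set a := _ / S; set b := _ / S.
  by rewrite ler_norml; case: (leP a pi); case: (leP b pi); case: (ger0P (a - b)); lra.
by rewrite -mulrBl normrM (gtr0_norm (x := S^-1)) ?invr_gt0// ler_pdivlMr// mulrC.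
Qed.

Lemma stretched_itv u : 0 <= stretched u <= pi.
Proof.
case/andP: S01 => S0 _.
rewrite /stretched ge_min lexx orbT andbT le_min pi_ge0 andbT.
by rewrite divr_ge0 ?acos_ge0 ?longitude_cos_itv// ltW.
Qed.

(* The cosine of the spherical distance between the images of [u] and [v] under
   the map that multiplies longitudes by [1 / S]. *)
Let kappa u v := r u * r v * cos (stretched u - stretched v) + dot u e * dot v e.

(** The squared chords split into radial, angular and vertical parts. The vertical parts agree, the
    radial one needs only [S <= 1], and the angular one is [key]. *)
Lemma longitude_stretching u v : enorm u = 1 -> enorm v = 1 ->
  S ^+ 2 * (2 - 2 * kappa u v) <=
  enorm (proj_perp e (u - v)) ^+ 2 + S ^+ 2 * dot (u - v) e ^+ 2.
Proof.
move=> u1 v1; case/andP: (S01) => S0 S1.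
have ru := sqr_r u1; have rv := sqr_r v1.
have ru0 : 0 <= r u := enorm_ge0 _.
have rv0 : 0 <= r v := enorm_ge0 _.
set m := stretched u - stretched v.
have mpi : `|m| <= pi.
  by have := stretched_itv u; have := stretched_itv v; rewrite ler_norml /m; lra.
pose D := dot (proj_perp e u) (proj_perp e v).
have key : r u * r v * (S ^+ 2 * (1 - cos m)) <= r u * r v - D.
  (* If a projection vanishes, its longitude is a mere default value, but both sides are 0. *)
  have [rr0|rr0] := eqVneq (r u * r v) 0.
    have : `|D| <= 0 by rewrite -rr0 normr_dot_le.
    by rewrite normr_le0 => /eqP ->; rewrite rr0 mul0r subr0.
  have [ru' rv'] : r u != 0 /\ r v != 0 by move: rr0; rewrite mulf_eq0 negb_or => /andP[].
  pose q := D / (r u * r v).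
  have rrp : 0 < r u * r v by rewrite lt_def rr0 mulr_ge0.
  have q1 : -1 <= q <= 1.
    rewrite -ler_norml normrM normfV (gtr0_norm rrp) ler_pdivrMr// mul1r.
    exact: normr_dot_le.
  have -> : D = r u * r v * cos (acos q) by rewrite acosK ?in_itv// mulrC divfK.
  rewrite -[X in _ <= X - _]mulr1 -mulrBr ler_pM2l// -(cos_norm m).
  apply: scaled_versine_le; rewrite ?acos_lepi ?normr_ge0 ?mpi ?(ltW S0)//.
  exact: le_trans (stretched_lip _ _) (longitude_lip ru' rv').
rewrite proj_perpB sqr_enormB -/(r u) -/(r v) -/D dotDl dotNl /kappa -/m.
have sq : 0 <= (r u - r v) ^+ 2 := sqr_ge0 _.
have S2 : 0 <= 1 - S ^+ 2 by nra.
have := mulr_ge0 S2 sq.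
move: key; set q := r u * r v; set c := cos m => key.
have -> : (r u - r v) ^+ 2 = r u ^+ 2 + r v ^+ 2 - 2 * q by rewrite /q; ring.
have -> : (dot u e - dot v e) ^+ 2 = 2 - r u ^+ 2 - r v ^+ 2 - 2 * (dot u e * dot v e).
  by rewrite ru rv; ring.
lra.
Qed.

(** The image of [u] is the point [(a, a', s)] of the unit sphere of three-space, that of [u0] is
    [(1, 0, 0)], and [kappa u v] is the inner product of the images of [u] and [v]. The claim is the
    spherical triangle inequality for these three points. *)
Lemma stretched_dist_lip u v : enorm u = 1 -> enorm v = 1 ->
  -1 <= kappa u v <= 1 /\ `|stretched_dist u - stretched_dist v| <= acos (kappa u v).
Proof.
move=> u1 v1.
have ru := sqr_r u1; have rv := sqr_r v1.
have cu := cos2Dsin2 (stretched u); have cv := cos2Dsin2 (stretched v).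
have kE : kappa u v = r u * cos (stretched u) * (r v * cos (stretched v)) +
   (r u * sin (stretched u) * (r v * sin (stretched v)) + dot u e * dot v e).
  by rewrite /kappa cosB; ring.
set a := r u * cos (stretched u) in kE *; set b := r v * cos (stretched v) in kE *.
set a' := r u * sin (stretched u) in kE; set b' := r v * sin (stretched v) in kE.
set s := dot u e in kE; set t := dot v e in kE.
have ea : a ^+ 2 + a' ^+ 2 + s ^+ 2 = 1.
  by rewrite !exprMn -mulrDr cu mulr1 ru subrK.
have eb : b ^+ 2 + b' ^+ 2 + t ^+ 2 = 1.
  by rewrite !exprMn -mulrDr cv mulr1 rv subrK.
have k1 : -1 <= kappa u v <= 1.
  rewrite kE; have h1 := sqr_ge0 (a - b).
  have h2 := sqr_ge0 (a' - b'); have h3 := sqr_ge0 (s - t).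
  have h4 := sqr_ge0 (a + b); have h5 := sqr_ge0 (a' + b'); have h6 := sqr_ge0 (s + t).
  by nra.
split=> //; apply: acos_triangle => //; rewrite -/(r u) -/(r v) -/a -/b; [nra|nra|].
rewrite kE (_ : _ - _ = a' * b' + s * t); last by ring.
have -> : 1 - a ^+ 2 = a' ^+ 2 + s ^+ 2 by lra.
have -> : 1 - b ^+ 2 = b' ^+ 2 + t ^+ 2 by lra.
have := sqr_ge0 (a' * t - s * b'); nra.
Qed.

(** [M] is the length of a chord of the ellipsoid traced by [(w, S sigma)]; its image on the sphere
    has chord at most [M / S], and the first factor pays for replacing that chord by its arc. *)
Lemma stretched_dist_le u v
    (M := Num.sqrt (enorm (proj_perp e (u - v)) ^+ 2 + S ^+ 2 * dot (u - v) e ^+ 2)) :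
  enorm u = 1 -> enorm v = 1 ->
  (1 - M / (2 * S)) * (S * `|stretched_dist u - stretched_dist v|) <= M.
Proof.
move=> u1 v1; case/andP: (S01) => S0 _.
have [k1 Gk] := stretched_dist_lip u1 v1.
have := acos_mul_le_chord k1; set ch := Num.sqrt _ => chk.
have ch0 : 0 <= ch := sqrtr_ge0 _.
have SM : S * ch <= M.
  rewrite -[S]ger0_norm ?(ltW S0)// -sqrtr_sqr -sqrtrM ?sqr_ge0// ler_wsqrtr//.
  exact: longitude_stretching.
have M2 : ch / 2 <= M / (2 * S) by rewrite ler_pdivlMr ?mulr_gt0//; lra.
set g := `|_| in Gk *; have g0 : 0 <= g := normr_ge0 _.
have [h|h] := leP (1 - ch / 2) 0.
  apply: (@le_trans _ _ 0); last exact: sqrtr_ge0.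
  by apply: mulr_le0_ge0; [lra|rewrite mulr_ge0// ltW].
apply: (le_trans _ SM).
rewrite mulrCA ler_pM2l//; apply: (le_trans _ chk).
apply: (@le_trans _ _ ((1 - ch / 2) * g)); last by rewrite ler_wpM2l// ltW.
by rewrite ler_wpM2r//; lra.
Qed.

End LongitudeStretching.

(** * Uniform continuity and uniform subdivisions of the unit interval *)

Section Partitions.
Context {R : realType} {d : nat}.
Implicit Types (f : R -> 'rV[R]_d).

(** Heine's theorem, from the near-covering form of compactness; holding for all large [n], it lets
    both endpoint curves share one [n]. *)
Lemma uniform_continuity_segment f (dlt : R) :
  {within `[0, 1], continuous f} -> 0 < dlt ->
  \forall n \near \oo, forall x y : R, 0 <= x <= 1 -> 0 <= y <= 1 ->
    `|x - y| <= n.+1%:R^-1 -> enorm (f x - f y) <= dlt.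
Proof.
(* The 2 serves for passing through the centre [x], the [d] for [enorm_le_norm], and the 1 keeps the
   divisor positive. *)
move=> cf d0; pose k : R := dlt / (2 * (d%:R + 1)).
have d1 : 0 < d%:R + 1 :> R by rewrite ltr_wpDl.
have k0 : 0 < k by rewrite divr_gt0// mulr_gt0.
have /compact_near_coveringP cov := @segment_compact R 0 1.
pose P (n : nat) (x : R) := forall y : R, 0 <= x <= 1 -> 0 <= y <= 1 ->
  `|x - y| <= n.+1%:R^-1 -> enorm (f x - f y) <= dlt.
have : \forall n \near \oo, `[0, 1]%classic `<=` P n.
  suff loc : forall x : R, `[0, 1]%classic x -> \forall x' \near x & n \near \oo, P n x'.
    exact: cov.
  move=> x x01.
  have := (subspace_continuousP _ _).1 cf x x01 => /cvgrPdist_lt /(_ k k0).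
  rewrite near_withinE => /nbhs_ballP[eta /= eta0 H].
  have eta2 : 0 < eta / 2 by rewrite divr_gt0.
  near=> x' n => /= y x'01 y01 x'y.
  have xx' : `|x - x'| < eta / 2 by near: x'; exact: (nbhsx_ballx x _ eta2).
  have ny : n.+1%:R^-1 < eta / 2 :> R.
    by near: n; exact: (near_infty_natSinv_lt (PosNum eta2)).
  have xx'2 : `|x - x'| < eta by lra.
  have Hx' : `|f x - f x'| < k by apply: H; rewrite ?in_itv//=.
  have Hy : `|f x - f y| < k.
    apply: H; rewrite ?in_itv//= /ball/=.
    by rewrite (le_lt_trans (ler_distD x' _ _))// (splitr eta) ltrD// (le_lt_trans x'y).
  apply: (le_trans (enorm_le_norm _)).
  have : `|f x' - f y| <= 2 * k.
    by rewrite (le_trans (ler_distD (f x) _ _))// distrC; lra.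
  move=> /(ler_wpM2l (ler0n R d)) /le_trans; apply.
  have : dlt = k * (2 * (d%:R + 1)) by rewrite divfK// gt_eqF// mulr_gt0.
  lra.
apply: filterS => n Pn x y x01 y01.
by apply: Pn; rewrite /= ?in_itv.
Unshelve. all: by end_near. Qed.

(** The left end 0 is omitted, as [itv_partition] expects. *)
Definition uniform_partition n : seq R := mkseq (fun i => i.+1%:R / n.+1%:R) n.+1.

Lemma nth_uniform_partition n i : (i <= n.+1)%N ->
  nth 1 (0 :: uniform_partition n) i = i%:R / n.+1%:R.
Proof. by case: i => [|i] Hi /=; rewrite ?mul0r// nth_mkseq. Qed.

Lemma uniform_partitionP n : itv_partition 0 1 (uniform_partition n).
Proof.
split.
  apply/(pathP 1) => i; rewrite size_mkseq => Hi.
  rewrite nth_uniform_partition ?(ltnW Hi)// nth_mkseq//.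
  by rewrite ltr_pM2r ?invr_gt0// ltr_nat.
by rewrite (last_nth 1) size_mkseq nth_uniform_partition// divff// pnatr_eq0.
Qed.

Lemma polygon_length_uniform f n : polygon_length 0 1 f (uniform_partition n) =
  \sum_(0 <= i < n.+1) enorm (f (i.+1%:R / n.+1%:R) - f (i%:R / n.+1%:R)).
Proof.
rewrite /polygon_length size_mkseq; apply: eq_big_nat => i /andP[_ Hi].
by rewrite /comp !nth_uniform_partition// ltnW.
Qed.

Lemma motion_length_ge_polygon (A B : R -> 'rV[R]_d) (s : seq R) : itv_partition 0 1 s ->
  ((polygon_length 0 1 A s + polygon_length 0 1 B s)%:E <= motion_length A B)%E.
Proof.
by move=> sP; rewrite EFinD; apply: leeD; apply: ereal_sup_ubound; exists s.
Qed.

End Partitions.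

(** * The length bound along a fine subdivision *)

Section MotionBound.
Context {R : realType} {d : nat}.
Variables (e u0 : 'rV[R]_d) (th H : R).
Hypothesis eP : forall x, dot x e * dot e e = dot x e.
Hypotheses (u0_unit : enorm u0 = 1) (u0e : dot u0 e = 0).
Hypotheses (th_gt0 : 0 < th) (th_lepi : th <= pi).
Implicit Types (a b : 'rV[R]_d).

Let S := sin (th / 2).
Let c := cos (th / 2).
Let T := Num.sqrt (th ^+ 2 + 4 * H ^+ 2 * c ^+ 2).

Let S01 : 0 < S <= 1.
Proof. by rewrite sin_le1 andbT sin_gt0_pi//; move: th_gt0 th_lepi (@pi_gt0 R); lra. Qed.

Let sqr_T : T ^+ 2 = th ^+ 2 + (2 * H * c) ^+ 2.
Proof.
rewrite sqr_sqrtr; first by ring.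
by rewrite addr_ge0 ?sqr_ge0// mulr_ge0 ?sqr_ge0// mulr_ge0 ?sqr_ge0.
Qed.

Let T_gt0 : 0 < T.
Proof.
rewrite sqrtr_gt0 ltr_pwDl ?exprn_gt0//.
by rewrite mulr_ge0 ?sqr_ge0// mulr_ge0 ?sqr_ge0.
Qed.

(** The left side is the increment of one function of the position, so the bounds telescope over a
    subdivision. The bound [2 * S * eps] on the displacement makes the loss [M / (2 * S)] at most
    [eps]. *)
Lemma motion_step_bound a b a' b' (eps : R) : eps <= 1 ->
  enorm (b - a) = 1 -> enorm (b' - a') = 1 ->
  enorm (a' - a) + enorm (b' - b) <= 2 * S * eps ->
  (1 - eps) * (th * S) * (stretched_dist e u0 S (b' - a') - stretched_dist e u0 S (b - a))
    + 2 * H * c ^+ 2 * (dot (a' + b') e - dot (a + b) e)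
  <= T * (enorm (a' - a) + enorm (b' - b)).
Proof.
move=> eps1 u1 u1'; case/andP: (S01) => S0 S1; set D := _ + _ => Deps.
have D0 : 0 <= D by rewrite addr_ge0 ?enorm_ge0.
have S2 : 0 <= S ^+ 2 <= 1 by rewrite sqr_ge0 exprn_ile1// ltW.
have := @endpoint_speed_bound R d e eP (a' - a) (b' - b) (S ^+ 2) S2.
have -> : 1 - S ^+ 2 = c ^+ 2 by rewrite cos2sin2.
have -> : b' - b - (a' - a) = (b' - a') - (b - a).
  by apply/rowP => i; rewrite !mxE; ring.
have -> : a' - a + (b' - b) = (a' + b') - (a + b) by rewrite opprD addrACA.
have := stretched_dist_le eP u0_unit u0e S01 u1' u1.
set g := stretched_dist _ _ _ _ - _; set M := Num.sqrt _.
have M0 : 0 <= M := sqrtr_ge0 _.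
have M2 : M ^+ 2 = enorm (proj_perp e (b' - a' - (b - a))) ^+ 2 +
    S ^+ 2 * dot (b' - a' - (b - a)) e ^+ 2.
  by rewrite sqr_sqrtr ?addr_ge0 ?sqr_ge0// mulr_ge0 ?sqr_ge0.
rewrite -M2 dotDl dotNl -/D; set q := dot (a' + b') e - _ => gM DM.
have MD : M <= D.
  rewrite -(@ler_pXn2r _ 2) ?nnegrE//; apply: le_trans DM.
  by rewrite lerDl mulr_ge0 ?sqr_ge0.
have gM' : (1 - eps) * (S * g) <= M.
  apply: (@le_trans _ _ ((1 - eps) * (S * `|g|))).
    by rewrite ler_wpM2l ?ler_pM2l ?ler_norm//; lra.
  apply: le_trans gM; rewrite ler_wpM2r ?mulr_ge0 ?(ltW S0)//.
  by rewrite lerB// ler_pdivrMr ?mulr_gt0//; lra.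
(* Cauchy-Schwarz for [(th, 2 * H * c)], of norm [T], and [(M, c * q)], of norm at most [D]. *)
have CS : th * M + 2 * H * c * (c * q) <= T * D.
  apply: (le_trans (ler_norm _)).
  rewrite -(@ler_pXn2r _ 2) ?nnegrE ?mulr_ge0 ?sqrtr_ge0//.
  rewrite real_normK ?num_real// exprMn.
  apply: (@le_trans _ _ (T ^+ 2 * (M ^+ 2 + (c * q) ^+ 2))); last first.
    by rewrite ler_wpM2l ?sqr_ge0// exprMn.
  rewrite sqr_T; have := sqr_ge0 (th * (c * q) - 2 * H * c * M).
  by lra.
apply: le_trans CS.
have := ler_wpM2l (ltW th_gt0) gM'; lra.
Qed.

Let enorm_proj_perp u : enorm u = 1 -> dot u e = 0 -> enorm (proj_perp e u) = 1.
Proof. by move=> u1 ue; rewrite /proj_perp ue scale0r subr0. Qed.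

Let stretched_dist_start : stretched_dist e u0 S u0 = 0.
Proof.
rewrite /stretched_dist /stretched /longitude enorm_proj_perp// -sqr_enorm u0_unit.
by rewrite expr1n divr1 acos1 mul0r (min_idPl (pi_ge0 R)) cos0 mulr1 acos1.
Qed.

(** On the equator the distance is the stretched longitude itself, and the cap is inactive because
    [th <= pi * S]. *)
Let stretched_dist_end u : enorm u = 1 -> dot u e = 0 -> th = acos (dot u0 u) ->
  stretched_dist e u0 S u = th / S.
Proof.
move=> u1 ue thE; case/andP: (S01) => S0 _.
have thS : th / S <= pi.
  by rewrite ler_pdivrMr// mul_pi_le_sin_half// th_lepi ltW.
rewrite /stretched_dist /stretched /longitude enorm_proj_perp// divr1 -thE.
rewrite (min_idPl thS) mul1r cosK// in_itv/= thS andbT.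
by rewrite divr_ge0 ?ltW.
Qed.

Lemma motion_length_bound (A B : R -> 'rV[R]_d) :
  {within `[0, 1], continuous A} -> {within `[0, 1], continuous B} ->
  (forall t, 0 <= t <= 1 -> enorm (B t - A t) = 1) ->
  B 0 - A 0 = u0 -> dot (B 1 - A 1) e = 0 -> th = acos (dot u0 (B 1 - A 1)) ->
  dot (A 1 - A 0) e = H -> (T%:E <= motion_length A B)%E.
Proof.
move=> cA cB AB1 AB0 u1e thE HE; case/andP: (S01) => S0 S1.
apply/lee_addgt0Pr => x x0.
pose eps := Num.min (x / T) 1.
have eps0 : 0 < eps by rewrite lt_min ltr01 andbT divr_gt0.
have eps1 : eps <= 1 by rewrite ge_min lexx orbT.
have epsT : eps * T <= x by rewrite -ler_pdivlMr// ge_min lexx.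
have dlt0 : 0 < S * eps by rewrite mulr_gt0.
have [n [nA nB]] : exists n,
   (forall s t : R, 0 <= s <= 1 -> 0 <= t <= 1 -> `|s - t| <= n.+1%:R^-1 ->
      enorm (A s - A t) <= S * eps) /\
   (forall s t : R, 0 <= s <= 1 -> 0 <= t <= 1 -> `|s - t| <= n.+1%:R^-1 ->
      enorm (B s - B t) <= S * eps).
  have := filterI (uniform_continuity_segment cA dlt0)
    (uniform_continuity_segment cB dlt0).
  by move=> [n _ Hn]; exists n; exact: (Hn n (leqnn n)).
apply: (le_trans _ (leeD (motion_length_ge_polygon A B (uniform_partitionP n)) (lexx x%:E))).
rewrite -EFinD lee_fin !polygon_length_uniform -big_split/=.
set P := \sum_(_ <= _ < _) _.
pose F (i : nat) := (1 - eps) * (th * S) *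
    stretched_dist e u0 S (B (i%:R / n.+1%:R) - A (i%:R / n.+1%:R))
  + 2 * H * c ^+ 2 * dot (A (i%:R / n.+1%:R) + B (i%:R / n.+1%:R)) e.
have : F n.+1 - F 0%N <= T * P.
  rewrite -telescope_sumr// /P mulr_sumr; apply: ler_sum_nat => i /andP[_ Hi].
  have N0 : 0 < n.+1%:R :> R by rewrite ltr0n.
  have i01 : 0 <= (i%:R / n.+1%:R : R) <= 1.
    by rewrite divr_ge0// ler_pdivrMr// mul1r ler_nat ltnW.
  have si01 : 0 <= (i.+1%:R / n.+1%:R : R) <= 1.
    by rewrite divr_ge0// ler_pdivrMr// mul1r ler_nat.
  have dist : `|i.+1%:R / n.+1%:R - i%:R / n.+1%:R| <= (n.+1%:R^-1 : R).
    by rewrite -mulrBl -natrB// subSnn mul1r ger0_norm// invr_ge0.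
  apply: le_trans (motion_step_bound eps1 (AB1 _ i01) (AB1 _ si01) _); last first.
    by have := nA _ _ si01 i01 dist; have := nB _ _ si01 i01 dist; lra.
  by rewrite /F; lra.
have u11 := AB1 1 _; rewrite ler01 lexx in u11; have {}u11 := u11 isT.
rewrite /F mul0r divff ?pnatr_eq0// AB0 stretched_dist_start stretched_dist_end//.
(* At both ends [B - A] is orthogonal to [e], so [A + B] has the same component along [e] as
   [2 *: A]. *)
have dE : dot (A 1 + B 1) e - dot (A 0 + B 0) e = 2 * H.
  have -> : A 1 + B 1 = 2 *: A 1 + (B 1 - A 1) by apply/rowP => i; rewrite !mxE; ring.
  have -> : A 0 + B 0 = 2 *: A 0 + u0 by rewrite -AB0; apply/rowP => i; rewrite !mxE; ring.
  by rewrite !dotDl !dotZl u0e; move: u1e HE; rewrite !dotDl !dotNl; lra.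
rewrite mulr0 add0r -addrA -mulrBr dE.
have -> : (1 - eps) * (th * S) * (th / S) + 2 * H * c ^+ 2 * (2 * H) =
    T ^+ 2 - eps * th ^+ 2.
  by rewrite sqr_T; field; rewrite gt_eqF.
have thT : th ^+ 2 <= T ^+ 2 by rewrite sqr_T lerDl sqr_ge0.
move=> TP.
have : T * (T - eps * T) <= T * P.
  apply: le_trans TP; have := ler_wpM2l (ltW eps0) thT; lra.
by rewrite ler_pM2l//; lra.
Qed.

End MotionBound.

(** * The common perpendicular of the two lines, and the reduction to it *)

Lemma common_perpendicular (R : realType) (d : nat) (u v w : 'rV[R]_d) :
  enorm u = 1 -> enorm v = 1 -> dot u v ^+ 2 != 1 ->
  exists s t : R, dot (w + t *: v - s *: u) u = 0 /\ dot (w + t *: v - s *: u) v = 0.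
Proof.
move=> u1 v1; set k := dot u v => k1.
have k1' : 1 - k ^+ 2 != 0 by rewrite subr_eq0 eq_sym.
have uu : dot u u = 1 by rewrite -sqr_enorm u1 expr1n.
have vv : dot v v = 1 by rewrite -sqr_enorm v1 expr1n.
(* Cramer's rule for two linear equations in [s] and [t], with determinant [1 - k ^+ 2] up to
   sign. *)
exists ((dot w u - dot w v * k) / (1 - k ^+ 2)), ((dot w u * k - dot w v) / (1 - k ^+ 2)).
by split; rewrite !dotE ?uu ?vv ?(dotC v u) -/k; field.
Qed.

Lemma set_dist_line_le (R : realType) (d : nat) (a b a' b' : 'rV[R]_d) (s t : R) :
  set_dist (line a b) (line a' b') <=
    enorm ((a' - a) + t *: (b' - a') - s *: (b - a)).
Proof.
apply: ge_inf; first by exists 0 => _ [p _ [q _ <-]]; exact: enorm_ge0.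
exists (a + s *: (b - a)); first by exists s.
exists (a' + t *: (b' - a')); first by exists t.
by rewrite -enormN; congr enorm; apply/rowP => i; rewrite !mxE; ring.
Qed.

Theorem theorem2 (R : realType) (d : nat) (hd : (2 <= d)%N)
    (A0 B0 A1 B1 : 'rV[R]_d)
    (unit0 : enorm (B0 - A0) = 1) (unit1 : enorm (B1 - A1) = 1)
    (h : R) (h_ge0 : 0 <= h)
    (h_dist : h = set_dist (line A0 B0) (line A1 B1))
    (theta : R) (theta_itv : - pi < theta <= pi)
    (theta_angle : `|theta| = angle (B0 - A0) (B1 - A1))
    (theta_bnd : 0 < `|theta| <= pi)
    (A B : R -> 'rV[R]_d) (motion : rigid_motion A0 B0 A1 B1 A B) :
  ((Num.sqrt (theta ^+ 2 + 4 * h ^+ 2 * cos (theta / 2) ^+ 2))%:E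
     <= motion_length A B)%E.
Proof.
case: motion => cA cB a0 b0 a1 b1 AB1; case/andP: theta_bnd => th0 thpi.
set u := B0 - A0 in unit0 theta_angle; set v := B1 - A1 in unit1 theta_angle.
have thE : `|theta| = acos (dot u v) by rewrite theta_angle /angle unit0 unit1 mulr1 divr1.
have -> : cos (theta / 2) = cos (`|theta| / 2).
  by rewrite -(cos_norm (theta / 2)) normrM (ger0_norm (x := 2^-1)).
rewrite -(real_normK (num_real theta)).
(* The cosine stays in the inequality between [h] and [H] because for opposite directions [H = 0] is
   chosen although [h] may be positive. *)
suff [e [H [eP [ue [ve [wH hH]]]]]] : exists e H,
    (forall x, dot x e * dot e e = dot x e) /\ dot u e = 0 /\ dot v e = 0 /\
    dot (A1 - A0) e = H /\
    h ^+ 2 * cos (`|theta| / 2) ^+ 2 <= H ^+ 2 * cos (`|theta| / 2) ^+ 2.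
  have := @motion_length_bound R d e u `|theta| H eP unit0 ue th0 thpi A B cA cB AB1.
  rewrite a0 b0 a1 b1 wH => /(_ erefl ve thE erefl); apply: le_trans.
  by rewrite lee_fin ler_wsqrtr//; move: hH; lra.
have uv1 := unit_dot_itv unit0 unit1.
(* When the term in [h] vanishes, [e = 0] is taken: then [proj_perp] is the identity and the bound
   is the angle alone. *)
have [hc|hc] := eqVneq (h * cos (`|theta| / 2)) 0.
  have dot0r x : dot x (0 : 'rV[R]_d) = 0 by rewrite -(scale0r 0) dotZr mul0r.
  exists 0, 0; rewrite -exprMn hc !dot0r expr0n/= mul0r.
  by do !split=> //; move=> x; rewrite !dot0r mulr0.
have thpi' : `|theta| != pi by apply: contra_neq hc => ->; rewrite cos_pihalf mulr0.
have h0 : h != 0 by apply: contra_neq hc => ->; rewrite mul0r.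
have uvn : dot u v ^+ 2 != 1.
  rewrite sqrf_eq1 negb_or; apply/andP; split; apply/eqP => uvE.
    by move: th0; rewrite thE uvE acos1 ltxx.
  by move: thpi'; rewrite thE uvE acosN1 eqxx.
have [s [t []]] := common_perpendicular (A1 - A0) unit0 unit1 uvn.
(* [p] joins a point of one line to a point of the other, whence [h <= enorm p], and [H = enorm p]
   may replace [h]. *)
set p := _ - _ => pu pv; exists ((enorm p)^-1 *: p), (enorm p).
have hp : h <= enorm p by rewrite h_dist set_dist_line_le.
have p0 : enorm p != 0 by rewrite gt_eqF// (lt_le_trans _ hp)// lt_def h0.
have pp : dot p p = enorm p ^+ 2 by rewrite sqr_enorm.
have wE : dot (A1 - A0) p = enorm p ^+ 2.
  have -> : A1 - A0 = p - t *: v + s *: u by apply/rowP => i; rewrite !mxE; ring.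
  by rewrite dotDl dotDl dotNl !dotZl (dotC v) (dotC u) pu pv pp; ring.
split=> [x|]; first by rewrite !dotZr dotZl pp; field.
rewrite !dotZr dotC pu dotC pv !mulr0 wE; do !split=> //; first by field.
by rewrite ler_wpM2r ?sqr_ge0// ler_pXn2r ?nnegrE ?enorm_ge0.
Qed.
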